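(* Let $t,a,v$ be integers with $1\le a\le t-2$ and $v>(a+1)t$, and let $\mathcal S=(V,B)$ be a Steiner system with parameters $S(t,t+a,v)$. Let $k$ be a field and let $J_B\subseteq k[V]$ be the cover ideal of $B$. Then $$J_B^{(t+a)}\nsubseteq J_B^{t}.$$
   Context: A Steiner system of type $S(t,n,v)$ is a set $V$ with $|V|=v$ together with a collection $B$ of $n$-element subsets of $V$ (blocks) such that each $t$-element subset of $V$ is contained in a unique block. Let $k[V]$ be the polynomial ring over $k$ with variables $x_i$ indexed by $i\in V$. For $\sigma\subseteq V$ let $\mathfrak p_\sigma=(x_i : i\in\sigma)\subseteq k[V]$. The cover ideal of $B$ is $J_B=\bigcap_{\sigma\in B}\mathfrak p_\sigma$. For a radical ideal $J$, the $m$-th symbolic power is $J^{(m)}=\bigcap_{\mathfrak p\in\mathrm{Ass}(J)}\mathfrak p^m$. *)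

(* Defs.v *)
From HB Require Import structures.
From mathcomp Require Import all_boot all_order all_algebra.
From mathcomp Require Import ring_quotient boolp classical_sets.
From mathcomp Require Import mpoly.

Set Implicit Arguments.
Unset Strict Implicit.
Unset Printing Implicit Defensive.

Import GRing.Theory.

Local Open Scope ring_scope.
Local Open Scope classical_set_scope.

(* Ideals of a commutative ring are (Prop-valued) sets of elements, since the
   ideals of ring_quotient are restricted to boolean predicates. *)
Section IdealsDefs.
Variable R : comNzRingType.
Implicit Types (S I J P : set R) (m : nat).

Definition ideal_gen S : set R :=
  [set x | exists n (r s : 'I_n -> R),
     (forall i, S (s i)) /\ x = \sum_(i < n) r i * s i].

Definition ideal_mul I J : set R :=
  ideal_gen [set x | exists2 f, I f & exists2 g, J g & x = f * g].

(* The zeroth power is the unit ideal. *)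
Definition ideal_pow I m : set R := iter m (ideal_mul I) setT.

Definition ideal_colon J (f : R) : set R := [set r | J (r * f)].

(* idealr_closed includes properness: 1 is not in the ideal. *)
Definition prime_ideal P : Prop :=
  idealr_closed [pred x | `[< P x >]] /\
  prime_idealr_closed [pred x | `[< P x >]].

(* The associated primes of the module R/J: the primes that are the
   annihilator of the class of some f. *)
Definition Ass J : set (set R) :=
  [set P | prime_ideal P /\ exists f : R, P = ideal_colon J f].

(* The symbolic power in the convention used for radical J, with the
   intersection of the ordinary powers of the associated primes. *)
Definition symbolic_power J m : set R :=
  \bigcap_(P in Ass J) ideal_pow P m.

End IdealsDefs.

Definition steiner_system (V : finType) (B : {set {set V}}) (t n v : nat) : Prop :=
  [/\ #|V| = v,
      forall b : {set V}, b \in B -> #|b| = n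
    & forall s : {set V}, #|s| = t ->
        exists! b : {set V}, b \in B /\ s \subset b].

Section CoverIdeal.
Variables (k : fieldType) (V : finType).

(* k[V] is {mpoly k[#|V|]}, through the enumeration of V. *)
Definition var (i : V) : {mpoly k[#|V|]} := 'X_(enum_rank i).

Definition prime_of (s : {set V}) : set {mpoly k[#|V|]} :=
  ideal_gen [set f | exists2 i : V, i \in s & f = var i].

Definition cover_ideal (B : {set {set V}}) : set {mpoly k[#|V|]} :=
  \bigcap_(s in [set b | b \in B]) prime_of s.

End CoverIdeal.

Arguments cover_ideal k {V} B.

(* Main.v *)
(* The product F of all variables lies in p_b^(t+a) for every block b, hence in
   the symbolic power, since a prime containing the cover ideal J contains some
   p_b.  If F were in J^t, reading off exponents would split V into t disjoint
   covers: a t-colouring in which every block sees every colour.  As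
   #|V| > (a+1)t, some a+2 <= t points share a colour; a block through t points
   including these has only t-2 further points, so it sees at most t-1 colours. *)

Require Import Defs.
From mathcomp Require Import boolp classical_sets.
From mathcomp Require Import all_boot all_order all_algebra.
From mathcomp Require Import mpoly zify.

Import GRing.Theory.
Local Open Scope ring_scope.

(** * Generated ideals, powers and primes *)

Section Ideals.
Context {R : comNzRingType}.
Implicit Types (S I J P : set R) (r x y : R).

Lemma ideal_gen_incl S x : S x -> ideal_gen S x.
Proof.
by move=> Sx; exists 1, (fun=> 1), (fun=> x); split; rewrite // big_ord1 mul1r.
Qed.

Lemma ideal_genMl S r x : ideal_gen S x -> ideal_gen S (r * x).
Proof.
case=> n [c [s [Ss ->]]]; exists n, (fun i => r * c i), s; split=> //.
by rewrite mulr_sumr; apply: eq_bigr => i _; rewrite mulrA.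
Qed.

Lemma sub_ideal_gen S S' :
  (S `<=` S')%classic -> (ideal_gen S `<=` ideal_gen S')%classic.
Proof.
move=> sSS' x [n [c [s [Ss ->]]]]; exists n, c, s; split=> // i.
exact: sSS'.
Qed.

Lemma sub_ideal_pow I J n :
  (I `<=` J)%classic -> (ideal_pow I n `<=` ideal_pow J n)%classic.
Proof.
move=> sIJ; elim: n => // n IHn; apply: sub_ideal_gen.
move=> x [f If [g Ig ->]].
by exists f; [exact: sIJ | exists g => //; exact: IHn].
Qed.

Lemma ideal_powMl I n r x : ideal_pow I n x -> ideal_pow I n (r * x).
Proof. by case: n => // n; exact: ideal_genMl. Qed.

Lemma ideal_pow_prod (T : eqType) (s : seq T) (F : T -> R) I :
  {in s, forall i, I (F i)} -> ideal_pow I (size s) (\prod_(i <- s) F i).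
Proof.
elim: s => [//|i s IHs] IF; rewrite big_cons /=.
apply: ideal_gen_incl; exists (F i); first by apply: IF; rewrite mem_head.
exists (\prod_(j <- s) F j) => //; apply: IHs => j js.
by apply: IF; rewrite inE js orbT.
Qed.

Lemma prime_ideal1 P : prime_ideal P -> ~ P 1.
Proof. by case=> -[_ P1 _] _ HP; move/negP: P1; apply; apply/asboolP. Qed.

Lemma prime_ideal_sum P n (r s : 'I_n -> R) :
  prime_ideal P -> (forall i, P (s i)) -> P (\sum_(i < n) r i * s i).
Proof.
move=> [[P0 _ PD] _] Ps; apply/asboolP.
(* The closure condition concerns [a * x + y]: [a = 1] gives sums, and [y = 0] gives multiples. *)
apply: (big_ind (fun x => `[< P x >])) => [|x y Px Py|i _]; first exact: P0.
  by have := PD 1 x y Px Py; rewrite mul1r.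
by have := PD (r i) (s i) 0 (asboolT (Ps i)) P0; rewrite addr0.
Qed.

Lemma prime_ideal_prod (T : Type) (s : seq T) (Q : pred T) (F : T -> R) P :
  prime_ideal P -> (forall i, Q i -> ~ P (F i)) ->
  ~ P (\prod_(i <- s | Q i) F i).
Proof.
move=> prP nPF; apply: (big_ind (fun x => ~ P x)) => //; first exact: prime_ideal1.
move=> x y nPx nPy Pxy; case: prP => _ /(_ x y (asboolT Pxy)).
by case/orP => /asboolP.
Qed.

End Ideals.

(** * Exponents of polynomials in ideals and their powers *)

Section Monomials.
Context {n : nat} {R : comNzRingType}.
Implicit Types (p q : {mpoly R[n]}) (S I : set {mpoly R[n]}).

(** Cancellation in a sum of products can only remove monomials, so each survivor is a product of a
    monomial of a coefficient and one of a generator. *)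
Lemma msupp_ideal_gen S p m : ideal_gen S p -> m \in msupp p ->
  exists q m', [/\ S q, m' \in msupp q & (m' <= m)%MM].
Proof.
case=> l [c [s [Ss ->]]] /msupp_sum_le /flattenP[ms /mapP[i _ ->]].
case/msuppM_le/allpairsP=> -[m1 m2] /= [_ m2s ->].
by exists (s i), m2; split; rewrite ?lem_addl.
Qed.

Lemma msupp_ideal_pow I l p m : ideal_pow I l p -> m \in msupp p ->
  exists2 g : nat -> 'X_{1..n},
    forall j, (j < l)%N -> exists2 q, I q & g j \in msupp q
  & forall i, (\sum_(j < l) g j i <= m i)%N.
Proof.
elim: l p m => [|l IHl] p m.
  by move=> _ _; exists (fun=> 0%MM) => // i; rewrite big_ord0.
move=> /msupp_ideal_gen Hp /Hp [q [m' [[f If [h Ih ->]]]]].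
case/msuppM_le/allpairsP=> -[m1 m2] /= [m1f m2h ->] /mnm_lepP le_m.
have [g gI le_g] := IHl _ _ Ih m2h.
(* The monomial from the new factor in [I] goes first; those from the power [l] are shifted by
   one. *)
exists (fun j => if j is j'.+1 then g j' else m1) => [[_|j /gI //]|i].
  by exists f.
rewrite big_ord_recl /=; apply: leq_trans (le_m i).
by rewrite mnmDE leq_add2l.
Qed.

End Monomials.

(** * Colourings of a Steiner system *)

Lemma pigeonhole_fibre {T : finType} {n d : nat} (c : T -> 'I_n) :
  (d * n < #|T|)%N -> exists j, (d < #|[set i | c i == j]|)%N.
Proof.
move=> ltT; apply/existsP; apply: contraLR ltT; rewrite negb_exists -leqNgt.
move=> /forallP small; rewrite -sum1_card (partition_big c predT) //=.
apply: (@leq_trans (\sum_(j < n) d)%N); last by rewrite sum_nat_const card_ord mulnC.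
apply: leq_sum => j _; have := small j; rewrite -leqNgt; apply: leq_trans.
by rewrite -sum1_card; under [leqRHS]eq_bigl => i do rewrite inE.
Qed.

Lemma exists_subset_card {T : finType} (A : {set T}) {n : nat} :
  (n <= #|A|)%N -> exists2 Z : {set T}, Z \subset A & #|Z| = n.
Proof.
rewrite cardE => le_n; exists [set x in take n (enum A)].
  by apply/subsetP => x; rewrite inE => /mem_take; rewrite mem_enum.
rewrite cardsE (card_uniqP _) ?take_uniq ?enum_uniq // size_take_min.
exact/minn_idPl.
Qed.

Lemma steiner_block_misses_colour (t a v : nat) (V : finType)
    (B : {set {set V}}) (c : V -> 'I_t) :
  (a + 2 <= t)%N -> ((a + 1) * t < v)%N -> steiner_system B t (t + a) v ->
  exists2 b, b \in B & exists j, forall i, i \in b -> c i != j.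
Proof.
move=> le_at lt_v [cardV cardB blockB]; rewrite -cardV in lt_v.
have [j lt_j] := pigeonhole_fibre c lt_v.
have {lt_j} [Z sZj cardZ] : exists2 Z : {set V},
    Z \subset [set i | c i == j] & #|Z| = (a + 2)%N.
  by apply: exists_subset_card; rewrite addn2 -addn1.
(* [Y] completes [Z] to [t] points; there is room for it because [t <= (a + 1) * t < #|V|]. *)
have [Y sYZ cardY] : exists2 Y : {set V}, Y \subset ~: Z & #|Y| = (t - (a + 2))%N.
  apply: exists_subset_card; rewrite cardsCs setCK cardZ leq_sub2r //.
  by rewrite (leq_trans _ (ltnW lt_v)) // leq_pmull // addn1.
have /blockB [b [[bB sb] _]] : #|Z :|: Y| = t.
  rewrite cardsU cardZ cardY disjoint_setI0 ?cards0 ?subn0 ?subnKC //.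
  by rewrite disjoints_subset -setCS setCK.
exists b => //.
(* [Z] contributes only the colour [j], and the other [t + a - (a + 2) = t - 2] points of [b] at
   most one colour each. *)
have: (#|c @: b| < t)%N.
  have sZb : Z \subset b := subset_trans (subsetUl Z Y) sb.
  rewrite -(setID b Z) imsetU (setIidPr sZb).
  apply: (@leq_ltn_trans (1 + #|b :\: Z|)).
    rewrite (leq_trans (leq_card_setU _ _)) // leq_add ?leq_imset_card //.
    rewrite -(cards1 j) subset_leq_card //; apply/subsetP => _ /imsetP[i iZ ->].
    by have := subsetP sZj i iZ; rewrite !inE.
  by rewrite cardsD (setIidPr sZb) cardZ cardB //; lia.
rewrite ltnNge => /negP few; have /existsP[l /imsetP nl] : [exists l, l \notin c @: b].
  apply/existsP; apply: contra_notP few => all_seen; rewrite -[t in (t <= _)%N]card_ord.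
  apply/subset_leq_card/subsetP => l _; apply/negPn/negP => nl.
  by apply: all_seen; exists l.
by exists l => i ib; apply: contra_not_neq nl => <-; exists i.
Qed.

(** * Cover ideals and the product of all variables *)

Section CoverIdeals.
Context {k : fieldType} {V : finType}.
Implicit Types (B : {set {set V}}) (b : {set V}).

Lemma msupp_prime_of b (p : {mpoly k[#|V|]}) m :
  prime_of b p -> m \in msupp p -> exists2 i, i \in b & (0 < m (enum_rank i))%N.
Proof.
move=> /msupp_ideal_gen bp /bp [_ [m' [[i ib ->]]]].
move=> /mem_msuppXP <- /mnm_lepP /(_ (enum_rank i)); rewrite mnm1E eqxx => lt_m.
by exists i.
Qed.

Lemma prime_of_sub_prime B (P : set {mpoly k[#|V|]}) :
  prime_ideal P -> (cover_ideal k B `<=` P)%classic ->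
  exists2 b, b \in B & (prime_of b `<=` P)%classic.
Proof.
(* Were there no such b, the product of the variables outside P would meet
   every block, so it would lie in the cover ideal but not in P. *)
move=> prP sJP; apply: contrapT => noB.
pose G := \prod_(i : V | ~~ `[< P (var k i) >]) var k i.
have: ~ P G by apply: prime_ideal_prod => // i /asboolP.
apply; apply: sJP => b /= bB.
have [i ib nPi] : exists2 i, i \in b & ~ P (var k i).
  apply: contrapT => allP; apply: noB; exists b => // _ [n [r [s [bs ->]]]].
  apply: prime_ideal_sum => // j; have [i ib ->] := bs j.
  by apply: contrapT => nPi; apply: allP; exists i.
rewrite /G (bigD1 i) /=; last exact/asboolP.
by rewrite mulrC; apply/ideal_genMl/ideal_gen_incl; exists i.
Qed.

Lemma prod_var_symbolic_power B n : (forall b, b \in B -> #|b| = n) ->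
  symbolic_power (cover_ideal k B) n (\prod_(i : V) var k i).
Proof.
move=> cardB P [prP [f defP]].
have [|b bB sbP] := prime_of_sub_prime B _ prP.
  (* [P] is a colon ideal of the cover ideal, so it contains the cover ideal. *)
  move=> x Jx; rewrite defP => b bB.
  by rewrite mulrC; apply: ideal_genMl; apply: Jx.
(* The [n] variables indexed by [b] already give an element of the [n]-th power of [prime_of b]; the
   others are a cofactor. *)
apply: (sub_ideal_pow _ _ _ sbP); rewrite (bigID (mem b)) /= mulrC.
apply: ideal_powMl; rewrite -(cardB b bB) [#|b|]cardE -big_enum /=.
apply: ideal_pow_prod => i; rewrite mem_enum => ib.
by apply: ideal_gen_incl; exists i.
Qed.

(** Membership yields [n] monomials of elements of the cover ideal whose product divides the
    squarefree monomial. Their supports are therefore disjoint, and each meets every block; a point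
    is coloured by the support containing it. *)
Lemma prod_var_ideal_pow B n : (0 < n)%N ->
  ideal_pow (cover_ideal k B) n (\prod_(i : V) var k i) ->
  exists c : V -> 'I_n, forall b j, b \in B -> exists2 i, i \in b & c i = j.
Proof.
case: n => // n _; rewrite mprodXE => /msupp_ideal_pow.
set m := (\sum_(i : V) _)%MM; case/(_ m); first by rewrite msuppX mem_head.
move=> g gJ le_g.
have m1 i : m (enum_rank i) = 1%N.
  rewrite mnm_sumE (bigD1 i) //= mnm1E eqxx big1 // => j /negPf ji.
  by rewrite mnm1E (inj_eq enum_rank_inj) ji.
(* Points in no support get the default colour, which is harmless: extra points of a colour never
   hurt. *)
pose c i := odflt ord0 [pick j : 'I_n.+1 | (0 < g j (enum_rank i))%N].
exists c => b j bB; have [q Jq gq] := gJ j (ltn_ord j).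
have [i ib g_gt0] := msupp_prime_of _ _ _ (Jq b bB) gq.
exists i => //; rewrite /c; case: pickP => [l gl_gt0|/(_ j)]; last by rewrite g_gt0.
(* If [l] and [j] differed, the exponents of [g l] and [g j] at [i] would add up to at least 2,
   exceeding [m]. *)
apply: contraTeq (le_g (enum_rank i)) => /= nlj.
rewrite m1 -ltnNge (bigD1 l) //= (bigD1 j) 1?eq_sym //= addnA.
exact: leq_trans (leq_add gl_gt0 g_gt0) (leq_addr _ _).
Qed.

End CoverIdeals.

Theorem proposition4p10 (t a v : nat) (V : finType) (B : {set {set V}})
    (k : fieldType) :
  (1 <= a)%N -> (a + 2 <= t)%N -> ((a + 1) * t < v)%N ->
  steiner_system B t (t + a)%N v ->
  ~ (symbolic_power (cover_ideal k B) (t + a)%N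
       `<=` ideal_pow (cover_ideal k B) t)%classic.
Proof.
move=> _ le_at lt_v SB sub.
have t_gt0 : (0 < t)%N by lia.
have [_ cardB _] := SB.
have [c cB] := prod_var_ideal_pow _ _ t_gt0 (sub _ (prod_var_symbolic_power _ _ cardB)).
have [b bB [j nj]] := steiner_block_misses_colour _ _ _ _ _ c le_at lt_v SB.
have [i ib cij] := cB b j bB.
by have := nj i ib; rewrite cij eqxx.
Qed.
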